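(* Consider the scalar binary signaling game under the Stackelberg assumption (transmitter leads, receiver follows), as described in the context. Let $\tau\triangleq\frac{\pi_0^r(C^r_{10}-C^r_{00})}{\pi_1^r(C^r_{01}-C^r_{11})}$. If $\tau\le0$ or $\tau=\infty$, the Stackelberg equilibrium of the binary signaling game is non-informative. Otherwise, i.e., if $0<\tau<\infty$, let $d\triangleq\frac{|S_1-S_0|}{\sigma}$, $d_{\max}\triangleq\frac{\sqrt{P_0}+\sqrt{P_1}}{\sigma}$, $\zeta\triangleq\mathrm{sgn}(C^r_{01}-C^r_{11})$, $k_0\triangleq\pi_0^t\zeta(C^t_{10}-C^t_{00})\tau^{-1/2}$ and $k_1\triangleq\pi_1^t\zeta(C^t_{01}-C^t_{11})\tau^{1/2}$. Then the value $d^*$ of $d$ at the Stackelberg equilibrium is characterized as follows, where $d^*=0$ stands for a non-informative equilibrium and a nonzero $d^*$ corresponds to an informative equilibrium. 1. If $\ln\tau\,(k_0-k_1)<0$ and $k_0+k_1<0$, then $d^*=\min\left\{d_{\max},\sqrt{\left|\frac{2\ln\tau\,(k_0-k_1)}{k_0+k_1}\right|}\right\}$. 2. If $\ln\tau\,(k_0-k_1)<0$ and $k_0+k_1\ge0$, then $d^*=d_{\max}$. 3. If $\ln\tau\,(k_0-k_1)\ge0$ and $k_0+k_1<0$, then $d^*=0$ (non-informative). 4. If $\ln\tau\,(k_0-k_1)\ge0$ and $k_0+k_1\ge0$, then: (a) if $d_{\max}^2<\left|\frac{2\ln\tau\,(k_0-k_1)}{k_0+k_1}\right|$, then $d^*=0$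 (non-informative); (b) if $d_{\max}^2\ge\left|\frac{2\ln\tau\,(k_0-k_1)}{k_0+k_1}\right|$, then $d^*$ is determined by the sign of $$\left(\frac{k_1}{k_0\tau}\right)^{\mathrm{sgn}(\ln\tau)}\mathcal Q\left(\frac{|\ln\tau|}{d_{\max}}-\frac{d_{\max}}{2}\right)-\mathcal Q\left(\frac{|\ln\tau|}{d_{\max}}+\frac{d_{\max}}{2}\right):$$ $d^*=d_{\max}$ if this quantity is positive, $d^*=0$ if it is negative (and both are optimal if it is zero).
   Context: Binary signaling game: there are two hypotheses $\mathcal H_0: Y=S_0+N$ and $\mathcal H_1: Y=S_1+N$, where $Y$ takes values in $\Gamma=\mathbb R$, $S_0,S_1\in\mathbb R$ are deterministic signals and $N\sim\mathcal N(0,\sigma^2)$, $\sigma>0$. The transmitter ($t$) chooses $\mathcal S=\{S_0,S_1\}$ in $\mathbb S=\{\mathcal S:|S_0|^2\le P_0,\ |S_1|^2\le P_1\}$, with power limits $P_0,P_1>0$. The receiver ($r$) chooses a decision rule $\delta\in\Delta$, i.e. a partition of $\Gamma$ into $\Gamma_0,\Gamma_1$, deciding $\mathcal H_i$ when $y\in\Gamma_i$. Put $\mathsf P_{ji}=\Pr(Y\in\Gamma_j\mid\mathcal H_i)$. For $j\in\{t,r\}$, player $j$ has priors $\pi_0^j,\pi_1^j\ge0$ with $\pi^j_0+\pi^j_1=1$ and costs $C^j_{kl}\ge0$ (cost of deciding $\mathcal H_k$ when $\mathcal H_l$ is true); the priors are mutually absolutely continuous: $\pi_i^t=0\iff\pi_i^r=0$.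 Player $j$ has Bayes risk $$r^j(\mathcal S,\delta)=\pi_0^j(C^j_{00}\mathsf P_{00}+C^j_{10}\mathsf P_{10})+\pi_1^j(C^j_{01}\mathsf P_{01}+C^j_{11}\mathsf P_{11}).$$ Stackelberg equilibrium: a pair $(\mathcal S^*,\delta^*_{\mathcal S^*})$ such that $r^t(\mathcal S^*,\delta^*_{\mathcal S^*})\le r^t(\mathcal S,\delta^*_{\mathcal S})$ for all $\mathcal S\in\mathbb S$, where for every $\mathcal S$ the rule $\delta^*_{\mathcal S}$ satisfies $r^r(\mathcal S,\delta^*_{\mathcal S})\le r^r(\mathcal S,\delta)$ for all $\delta\in\Delta$. Notation: $\mathcal Q(x)=\frac1{\sqrt{2\pi}}\int_x^\infty e^{-t^2/2}\,dt$; $\mathrm{sgn}(x)=-1,0,1$ for $x<0$, $x=0$, $x>0$. $\tau$ is an extended real number: when its denominator vanishes and its numerator does not, it equals $\pm\infty$ according to the sign of the numerator. The ratio $\left|\frac{2\ln\tau(k_0-k_1)}{k_0+k_1}\right|$ is read as $+\infty$ when $k_0+k_1=0$ and $\ln\tau\,(k_0-k_1)\neq0$; the quotients occurring in the characterization are otherwise understood to be well defined. An equilibrium is called non-informative (babbling) if it is achieved with a message that is useless for the receiver, i.e. $S_0^*=S_1^*$ and $\delta^*$ uses only the priors, or $\delta^*$ ignores the observation and always decides the same hypothesis; otherwise it is informative.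
   Formalization: In case 4(b) with τ=1, where the receiver is indifferent if S_0=S_1, d*=d_max is proved only for receivers whose rule at S_0=S_1 has P_10=P_01; for other tie-breaking, where the claim can fail, only d*∈{0,d_max} is proved. The cases τ=0/0 and, in case 4, ratio 0/0 are excluded. *)

(* Defs.v *)
From HB Require Import structures.
From mathcomp Require Import all_boot all_order all_algebra.
From mathcomp Require Import all_classical all_reals all_analysis.

Set Implicit Arguments.
Unset Strict Implicit.
Unset Printing Implicit Defensive.

Import Order.TTheory GRing.Theory Num.Theory.
Import numFieldNormedType.Exports.

Local Open Scope classical_set_scope.
Local Open Scope ring_scope.

(* The hypotheses H_0 and H_1 are indexed by [false] and [true]. *)

Record player (R : realType) := Player {
  prior : bool -> R;
  cost : bool -> bool -> R  (* [cost k l]: deciding H_k when H_l is true *)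
}.

Definition player_wf (R : realType) (p : player R) : Prop :=
  [/\ forall i, 0 <= prior p i,
      prior p false + prior p true = 1 &
      forall k l, 0 <= cost p k l].

Section SignalingGame.
Context {R : realType}.
Implicit Types (sigma : R) (P : bool -> R) (p t r : player R).

Definition signals := bool -> R.

(* A measurable partition of the line: Gamma_j is the preimage of j. *)
Definition decision_rule := {mfun measurableTypeR R >-> bool}.

Definition feasible P (S : signals) : Prop := forall i, `|S i| ^+ 2 <= P i.

(* P_ji = Pr(S_i + N \in Gamma_j), where N has law N(0, sigma^2);
   the second parameter of [normal_prob] is the standard deviation. *)
Definition decision_prob sigma (S : signals) (delta : decision_rule)
    (j i : bool) : R :=
  fine (normal_prob 0 sigma [set n : R | delta (S i + n) = j]).

Definition bayes_risk sigma p (S : signals) (delta : decision_rule) : R :=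
  let Pr := decision_prob sigma S delta in
  prior p false * (cost p false false * Pr false false
                   + cost p true false * Pr true false)
  + prior p true * (cost p false true * Pr false true
                    + cost p true true * Pr true true).

Definition best_response sigma r (S : signals) (delta : decision_rule) : Prop :=
  forall delta', bayes_risk sigma r S delta <= bayes_risk sigma r S delta'.

(* The follower's strategy [delta] assigns a rule to every choice of signals;
   the equilibrium pair is (S, delta S). *)
Definition stackelberg sigma P t r (S : signals)
    (delta : signals -> decision_rule) : Prop :=
  [/\ feasible P S,
      forall S', feasible P S' -> best_response sigma r S' (delta S') &
      forall S', feasible P S' ->
        bayes_risk sigma t S (delta S) <= bayes_risk sigma t S' (delta S')].

Definition prior_cost p (k : bool) : R :=
  prior p false * cost p k false + prior p true * cost p k true.

(* Almost every observation is mapped to a decision that is optimal on the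
   basis of the priors alone. *)
Definition uses_only_priors r (delta : decision_rule) : Prop :=
  {ae (@lebesgue_measure R), forall y : R,
    forall k, prior_cost r (delta y) <= prior_cost r k}.

(* Rules are only determined up to null sets, hence probability one instead of
   a constant function. *)
Definition always_same_decision sigma (S : signals) (delta : decision_rule) :
    Prop :=
  exists j, forall i, decision_prob sigma S delta j i = 1.

Definition non_informative sigma r (S : signals) (delta : decision_rule) :
    Prop :=
  (S false = S true /\ uses_only_priors r delta)
  \/ always_same_decision sigma S delta.

Definition tau_num r : R := prior r false * (cost r true false - cost r false false).
Definition tau_den r : R := prior r true * (cost r false true - cost r true true).

(* The value at 0/0 is irrelevant: that case is excluded where tau is used. *)
Definition tau_ext r : \bar R :=
  if tau_den r != 0 then (tau_num r / tau_den r)%:E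
  else if 0 < tau_num r then +oo%E else -oo%E.

Definition dist sigma (S : signals) : R := `|S true - S false| / sigma.

Definition dist_max sigma P : R :=
  (Num.sqrt (P false) + Num.sqrt (P true)) / sigma.

Definition equilibrium_dists sigma P t r : set R :=
  [set d | exists S delta, stackelberg sigma P t r S delta /\ d = dist sigma S].

(* When the two signals coincide and tau = 1, every rule is a best response.
   For distinct signals and tau = 1 the best response has equal error
   probabilities; this convention keeps that property for equal signals. *)
Definition neutral_ties sigma P (delta : signals -> decision_rule) : Prop :=
  forall S, feasible P S -> S false = S true ->
    decision_prob sigma S (delta S) true false
    = decision_prob sigma S (delta S) false true.

Definition neutral_equilibrium_dists sigma P t r : set R :=
  [set d | exists S delta, [/\ stackelberg sigma P t r S delta,
             neutral_ties sigma P delta & d = dist sigma S]].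

Definition gaussQ (x : R) : R :=
  (Num.sqrt (2 * pi))^-1
  * \int[@lebesgue_measure R]_(u in `[x, +oo[) expR (- (u ^+ 2 / 2)).

(* |2 ln tau (k0 - k1) / (k0 + k1)|; the value at 0/0 is irrelevant. *)
Definition critical_ratio (tau k0 k1 : R) : \bar R :=
  if k0 + k1 == 0 then +oo%E
  else `|2 * ln tau * (k0 - k1) / (k0 + k1)|%:E.

End SignalingGame.

(* Main.v *)
Require Import Defs.
From HB Require Import structures.
From mathcomp Require Import all_boot all_order all_algebra.
From mathcomp Require Import all_classical all_reals all_analysis.
From mathcomp Require Import measurable_realfun ring lra.
Import Order.TTheory GRing.Theory Num.Theory.
Import numFieldNormedType.Exports.
Local Open Scope classical_set_scope.
Local Open Scope ring_scope.

Set Implicit Arguments.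
Unset Strict Implicit.
Unset Printing Implicit Defensive.

(** Write [P_i] for the probability of deciding [H_1] under [H_i].  The risk of
    a player is, up to a constant, [tau_num * P_0 - tau_den * P_1], that is, the
    integral over the region where [H_1] is decided of
    [tau_num * f_0 - tau_den * f_1], with [f_i] the normal density centred at
    the i-th signal ([regret]).  A decision rule is therefore a best response
    of the receiver when this integrand is nonpositive where it decides [H_1]
    and nonnegative elsewhere; if the integrand vanishes only on a null set,
    the risk exceeds the optimal one by the integral of its absolute value over
    the symmetric difference of the two regions, so that all best responses
    have the same [P_i] ([sign_rule_optimal], [sign_rule_unique]).

    If [tau <= 0] or [tau] is infinite, the integrand has a strict constant
    sign and every best response is almost surely constant
    ([degenerate_equilibria]).

    If [0 < tau < +oo], let [L = ln tau].  For distinct signals at normalized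
    distance [d], the best response is a likelihood ratio test, which cuts the
    line at one point, so that [P_0] and [P_1] are [Q(L/d + d/2)] and
    [Q(L/d - d/2)], or their complements when the costs of the receiver are
    reversed.  The risk of the transmitter is then a constant plus
    [k0 e^(L/2) Q(L/d + d/2) - k1 e^(-L/2) Q(L/d - d/2)], whose derivative in
    [d] is a positive factor times [L (k0 - k1) / d^2 - (k0 + k1) / 2]
    ([is_derive_gap]).  When [L <> 0], equal signals lead to a constant
    decision, whose risk is the limit at [d -> 0+] ([cvg_gap_at0]).  Since [d]
    ranges over [[0, dmax]] ([dist_range], [dist_surj]), the equilibrium
    distances are the minimizers on this segment of a function whose variations
    are dictated by the sign of the derivative ([dists_minimizers]), and the
    cases of the characterization are the possible shapes of that function
    ([minimizers_interior] to [minimizers_endpoints]); in the last one, the two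
    endpoints are compared by the sign of the displayed criterion
    ([profile_criterion]).

    When [tau = 1] and the signals coincide, every rule is a best response, and
    the risk of the transmitter may take every value between the two constant
    decisions; the limit at [d -> 0+] is the value in the middle, obtained by
    neutral ties ([transmitter_risk_neutral], [neutral_dists_minimizers]). *)

(** * The Gaussian distribution and its tail function *)

Section Gaussian.
Context {R : realType}.
Implicit Types (m s x y : R) (A : set R).
Local Notation mu := (@lebesgue_measure R).

(** The density of the standard normal distribution. *)
Definition std_density (u : R) : R :=
  (Num.sqrt (2 * pi))^-1 * expR (- (u ^+ 2 / 2)).

Lemma std_density_gt0 u : 0 < std_density u.
Proof.
by rewrite mulr_gt0 ?expR_gt0// invr_gt0 sqrtr_gt0 mulr_gt0// pi_gt0.
Qed.

Lemma continuous_std_density : continuous std_density.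
Proof.
move=> x; apply: cvgM; first exact: cvg_cst.
apply: (cvg_comp _ expR); last exact: continuous_expR.
apply: (@cvgN _ R^o); apply: cvgM; last exact: cvg_cst.
exact: sqr_continuous.
Qed.

Lemma normal_pdf_std m s x : 0 < s ->
  normal_pdf m s x = std_density ((x - m) / s) * s^-1.
Proof.
move=> s0; rewrite normal_pdfE ?gt_eqF// /std_density /normal_peak /normal_fun.
rewrite -(mulrnAr (s ^+ 2)) sqrtrM ?sqr_ge0// sqrtr_sqr gtr0_norm// -[pi *+ 2]mulr_natl.
rewrite invfM [in RHS]mulrC mulrA; congr (_ * expR _).
by rewrite mulNr; congr (- _); rewrite -mulr_natr; field; rewrite gt_eqF.
Qed.

Lemma normal_pdf_gt0 m s x : 0 < s -> 0 < normal_pdf m s x.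
Proof. by move=> s0; rewrite normal_pdf_std// mulr_gt0 ?invr_gt0// std_density_gt0. Qed.

Lemma integrable_std_density A : measurable A ->
  mu.-integrable A (EFin \o std_density).
Proof.
move=> mA; apply: (@integrableS _ _ _ _ setT) => //.
apply: eq_integrable (@integrable_normal_pdf R 0 1) => // x _.
by rewrite /= normal_pdf_std// subr0 invr1 !mulr1.
Qed.

Lemma gaussQE x : gaussQ x = \int[mu]_(u in `[x, +oo[) std_density u.
Proof.
rewrite /gaussQ -RintegralZl//.
have := integrableZl (mu := mu) (measurable_itv _) (Num.sqrt (2 * pi))
  (integrable_std_density (A := `[x, +oo[) (measurable_itv _)).
apply: eq_integrable => // u _ /=.
by rewrite -EFinM mulrA divff ?mul1r// gt_eqF// sqrtr_gt0 mulr_gt0// pi_gt0.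
Qed.

Lemma normal_prob_ray m s x : 0 < s ->
  normal_prob m s `[x, +oo[ = (gaussQ ((x - m) / s))%:E.
Proof.
move=> s0; rewrite gaussQE /Rintegral fineK; last first.
  exact/integrable_fin_num/integrable_std_density.
pose F y : R^o := (y - m) / s.
have F'E : F^`()%classic = cst s^-1.
  apply/funext => y; rewrite /F derive1E deriveM// deriveD// derive_cst scaler0.
  by rewrite add0r derive_id derive_cst addr0 scaler1.
rewrite [RHS](@increasing_ge0_integration_by_substitutiony R F std_density x).
- apply: eq_integral => y _; rewrite F'E /= normal_pdf_std//.
- by move=> y z _ _ yz; rewrite /F ltr_pM2r ?invr_gt0// ltrD2r.
- by rewrite F'E => ? _; exact: cvg_cst.
- by rewrite F'E; exact: is_cvg_cst.
- by rewrite F'E; exact: is_cvg_cst.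
- split; first by move=> z _; rewrite /F.
  apply: cvg_at_right_filter; apply: cvgM; last exact: cvg_cst.
  by apply: (@cvgB _ R^o); [exact: cvg_id|exact: cvg_cst].
- apply/gt0_cvgMly; last exact: cvg_addrr.
  by rewrite invr_gt0.
- by apply: continuous_subspaceT; exact: continuous_std_density.
- by move=> y _; exact/ltW/std_density_gt0.
Qed.

Lemma gaussQ_ge0 x : 0 <= gaussQ x.
Proof.
by rewrite gaussQE; apply: Rintegral_ge0 => u _; exact/ltW/std_density_gt0.
Qed.

(** If [N] has law [N(0, s^2)] then [m + N] has law [N(m, s^2)]; both laws give
    the same mass to the closed rays, which generate the Borel sets. *)
Lemma normal_prob_shift m s A : 0 < s -> measurable A ->
  normal_prob 0 s [set n | A (m + n)] = normal_prob m s A.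
Proof.
move=> s0 mA.
have mf : @measurable_fun _ _ (measurableTypeR R) (measurableTypeR R) setT
    (fun n : R => m + n) by apply: measurable_funD.
pose f := @mfun_Sub _ _ (measurableTypeR R) (measurableTypeR R) _ (mem_set mf).
apply: (@measure_unique _ R (measurableTypeR R) (@RGenCInfty.G R)
  (fun n => `[- n%:R, +oo[%classic) _ _ _ _
  (pushforward (normal_prob 0 s) f : {measure set (measurableTypeR R) -> \bar R})
  (normal_prob m s : {measure set (measurableTypeR R) -> \bar R})) => //.
- exact: RGenCInfty.measurableE.
- move=> _ _ [x ->] [y ->]; exists (Num.max x y).
  apply/seteqP; split => z /=; rewrite !in_itv/= !andbT ge_max.
    by move=> [-> ->].
  by move=> /andP[].
- by move=> i; exists (- i%:R).
- rewrite -subTset => x _; exists (Num.truncn `|x|).+1 => //=.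
  rewrite in_itv/= andbT lerNl -normrN (le_trans (ler_norm _))// ltW//.
  exact: truncnS_gt.
- move=> _ [x ->]; rewrite /pushforward.
  rewrite [X in normal_prob 0 s X = _](_ : _ = `[x - m, +oo[%classic).
    by rewrite normal_prob_ray// subr0; exact/esym/normal_prob_ray.
  by apply/seteqP; split => z /=; rewrite !in_itv/= !andbT lerBlDl.
- move=> k; rewrite /pushforward -ge0_fin_numE//.
  apply: fin_num_measure; rewrite -[X in measurable X]setTI.
  exact: (mf measurableT).
Qed.

Lemma normal_prob_open_ray m s x : 0 < s ->
  normal_prob m s `]x, +oo[ = (gaussQ ((x - m) / s))%:E.
Proof.
move=> s0; rewrite -normal_prob_ray// /normal_prob integral_itv_obnd_cbnd//.
by apply/measurable_EFinP; apply: measurable_funTS; exact: measurable_normal_pdf.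
Qed.

Lemma normal_prob_left_ray m s x : 0 < s ->
  normal_prob m s `]-oo, x[ = (1 - gaussQ ((x - m) / s))%:E.
Proof.
move=> s0; rewrite -setCitvr probability_setC//.
by rewrite EFinB; congr (_ - _)%E; exact: normal_prob_ray.
Qed.

Lemma gaussQN x : gaussQ (- x) = 1 - gaussQ x.
Proof.
apply: EFin_inj; have := @normal_prob_left_ray 0 1 x ltr01.
rewrite subr0 divr1 => <-; have := @normal_prob_ray 0 1 (- x) ltr01.
rewrite subr0 divr1 => <-.
rewrite /normal_prob [RHS]integral_itv_bndo_bndc; last first.
  by apply/measurable_EFinP; apply: measurable_funTS; exact: measurable_normal_pdf.
have := @ge0_integration_by_substitutionNy R (normal_pdf 0 1) (- x).
rewrite opprK => ->.
- apply: eq_integral => u _ /=; rewrite !normal_pdf_std// /std_density.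
  by rewrite !subr0 !divr1 sqrrN.
- by apply: continuous_subspaceT; exact: continuous_normal_pdf.
- by move=> u _; exact: normal_pdf_ge0.
Qed.

Lemma gaussQ0 : gaussQ 0 = 2^-1 :> R.
Proof. by have := gaussQN 0; rewrite oppr0; lra. Qed.

Lemma is_derive_gaussQ x : is_derive x 1 (@gaussQ R) (- std_density x).
Proof.
pose F y := \int[mu]_(t in [set` Interval -oo%O (BRight y)]) std_density t.
have -> : @gaussQ R = (fun y => 1 - F y).
  apply/funext => y; rewrite /F -Rintegral_itv_bndo_bndc; last first.
    exact: integrable_std_density.
  have [e] : (\int[mu]_(t in `]-oo, y[) std_density t)%:E = (1 - gaussQ y)%:E.
    rewrite /Rintegral fineK; last exact/integrable_fin_num/integrable_std_density.
    rewrite -[y in RHS]divr1 -[y in RHS]subr0 -normal_prob_left_ray//.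
    apply: eq_integral => u _.
    by rewrite normal_pdf_std// subr0 invr1 !mulr1.
  by rewrite e subKr.
have [dF F'] : derivable F x 1 /\ (F^`())%classic x = std_density x.
  apply: (@continuous_FTC1 _ std_density _ _ (x + 1)) => //.
  - by rewrite ltrDl.
  - exact: integrable_std_density.
  - by rewrite ltNyr.
  - exact: continuous_std_density.
have : is_derive x 1 F (std_density x) by split => //; rewrite -derive1E.
move=> dF1; rewrite -[- _]add0r.
exact: (is_deriveB (is_derive_cst (1 : R) x 1) dF1).
Qed.

Lemma gaussQ_decr x y : x < y -> gaussQ y < gaussQ x.
Proof.
move=> xy; have cQ : {within `[x, y], continuous (@gaussQ R)}.
  apply: derivable_within_continuous => z _.
  by have [] := is_derive_gaussQ z.
have [c _ e] := MVT xy (fun z _ => is_derive_gaussQ z) cQ.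
by rewrite -subr_lt0 e mulNr oppr_lt0 mulr_gt0 ?std_density_gt0// subr_gt0.
Qed.

Lemma gaussQ_gt0 x : 0 < gaussQ x.
Proof. by rewrite (le_lt_trans (gaussQ_ge0 (x + 1)))// gaussQ_decr// ltrDl. Qed.

Lemma gaussQ_lt1 x : gaussQ x < 1.
Proof. by have := gaussQ_gt0 (- x); rewrite gaussQN; lra. Qed.

(* The identity, as a random variable whose distribution function is that of
   the standard normal law. *)
Let idTR : measurableTypeR R -> R := idfun.

#[local] HB.instance Definition _ :=
  @isMeasurableFun.Build _ _ _ _ idTR (@measurable_id _ _ setT).

Lemma cvg_gaussQy : gaussQ x @[x --> +oo] --> (0 : R).
Proof.
pose X : {RV (normal_prob 0 1 : probability (measurableTypeR R) R) >-> R} := idTR.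
have /fine_cvgP [_] := cvg_cdfy1 X.
have -> : fine \o cdf X = (fun x => 1 - gaussQ x).
  apply/funext => x /=; rewrite /cdf /distribution /pushforward /=.
  rewrite -[x in RHS]divr1 -[x in RHS]subr0.
  have -> : normal_prob 0 1 (X @^-1` `]-oo, x]) = (1 - gaussQ ((x - 0) / 1))%:E.
    rewrite -normal_prob_left_ray// /normal_prob [RHS]integral_itv_bndo_bndc//.
    by apply/measurable_EFinP; apply: measurable_funTS; exact: measurable_normal_pdf.
  by [].
move=> h; rewrite -[0](subrr (1 : R)).
have -> : @gaussQ R = (fun x => 1 - (1 - gaussQ x)) by apply/funext => x; rewrite subKr.
by apply: (@cvgB _ R^o); [exact: cvg_cst|exact: h].
Qed.

End Gaussian.

(** * The risk of the transmitter as a function of the distance *)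

Section Analysis.
Context {R : realType}.
Implicit Types (l e A B d x y z : R).

Lemma is_derive_comp1 (f g : R -> R) x a b :
  is_derive x 1 f a -> is_derive (f x) 1 g b -> is_derive x 1 (g \o f) (b * a).
Proof.
move=> [df <-] [dg <-]; split.
  apply/derivable1_diffP/differentiable_comp; exact/derivable1_diffP.
by rewrite -!derive1E derive1_comp.
Qed.

(** The argument of the tail function giving the probability that the likelihood
    ratio of two signals at distance [d] exceeds [e^l]: under [H_0] for [e = 1],
    under [H_1] for [e = -1]. *)
Definition threshold l e d := l / d + e * d / 2.

Lemma is_derive_threshold l e x : x != 0 ->
  is_derive x 1 (threshold l e) (- l / x ^+ 2 + e / 2).
Proof.
move=> x0.
have h1 : is_derive x 1 (fun z : R => z^-1) (- x ^- 2).
  split; first exact: derivableV.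
  by rewrite deriveV// derive_id scaler1.
have -> : threshold l e = (l \*: (fun z : R => z^-1)) + ((e / 2) \*: (id : R -> R)).
  by apply/funext => z; rewrite /threshold /GRing.scale/= mulrAC.
have := is_deriveD (is_deriveZ l h1) (is_deriveZ (e / 2) (is_derive_id x 1)).
move=> /is_derive_eq; by apply; rewrite /GRing.scale/= mulr1 mulrN mulNr.
Qed.

(** The part of the transmitter's risk that depends on the distance [d] between
    the signals, when [l] is the logarithm of the threshold. *)
Definition gap l A B d :=
  A * expR (l / 2) * gaussQ (threshold l 1 d)
  - B * expR (- (l / 2)) * gaussQ (threshold l (- 1) d).

(** The common factor of the two densities in the derivative of [gap]: as
    [(l/d + d/2)^2] and [(l/d - d/2)^2] differ by [2 l], the densities at the two
    thresholds are equal up to [e^l]. *)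
Definition gap_weight l d :=
  (Num.sqrt (2 * pi))^-1 * expR (- (((l / d) ^+ 2 + d ^+ 2 / 4) / 2)).

Lemma gap_weight_gt0 l d : 0 < gap_weight l d.
Proof. by rewrite mulr_gt0 ?expR_gt0// invr_gt0 sqrtr_gt0 mulr_gt0// pi_gt0. Qed.

Lemma std_density_threshold l (e : bool) d : d != 0 ->
  std_density (threshold l ((- 1) ^+ e) d)
  = gap_weight l d * expR (- ((- 1) ^+ e * (l / 2))).
Proof.
move=> d0; rewrite /std_density /gap_weight -mulrA -expRD; congr (_ * expR _).
by rewrite /threshold; case: e; rewrite ?expr1 ?expr0; field.
Qed.

Lemma is_derive_gap l A B x : x != 0 ->
  is_derive x 1 (gap l A B)
    (gap_weight l x * (l * (A - B) / x ^+ 2 - (A + B) / 2)).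
Proof.
move=> x0.
have h e := is_derive_comp1 (is_derive_threshold l e x0) (is_derive_gaussQ _).
have -> : gap l A B = (A * expR (l / 2)) \*: (@gaussQ R \o threshold l 1)
    - (B * expR (- (l / 2))) \*: (@gaussQ R \o threshold l (- 1)).
  by [].
have := is_deriveB (is_deriveZ (A * expR (l / 2)) (h 1))
                   (is_deriveZ (B * expR (- (l / 2))) (h (- 1))).
move=> /is_derive_eq; apply; rewrite /GRing.scale/=.
have := std_density_threshold l false x0; rewrite expr0 mul1r => ->.
have := std_density_threshold l true x0; rewrite expr1 mulN1r opprK => ->.
have : expR (l / 2) * expR (- (l / 2)) = 1 by rewrite -expRD subrr expR0.
move: (expR _) (expR _) (gap_weight _ _) => p q w pq.
transitivity (w * (q * p) * (l * (A - B) / x ^+ 2 - (A + B) / 2)); last by rewrite pq mulr1.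
by field.
Qed.

(** The extension of [gap] by its limit at [0]: for [l > 0] both tails vanish
    there.  For [l = 0], the quotient [l / d] is [0] for every [d], including
    [d = 0], and [gap] needs no correction. *)
Definition gap0 l A B d := if (d == 0) && (l != 0) then 0 else gap l A B d.

Lemma gap0N l A B d : gap0 l (- A) (- B) d = - gap0 l A B d.
Proof. by rewrite /gap0 /gap; case: ifP => _; ring. Qed.

Lemma cvg_gap_at0 l A B : 0 <= l ->
  gap l A B d @[d --> 0^'+] --> gap0 l A B 0.
Proof.
rewrite le_eqVlt => /predU1P[<-|l0].
  rewrite /gap0 eqxx andbF; apply: cvg_at_right_filter.
  have -> : gap 0 A B = fun d => A * expR (0 / 2) * gaussQ (d / 2)
      - B * expR (- (0 / 2)) * gaussQ (- d / 2).
    by apply/funext => d; rewrite /gap /threshold (mul0r d^-1) !add0r mul1r mulN1r.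
  have cQ : continuous (@gaussQ R).
    move=> x; apply: differentiable_continuous; apply/derivable1_diffP.
    by have [] := is_derive_gaussQ x.
  apply: (@cvgB _ R^o); apply: cvgM.
  - exact: cvg_cst.
  - apply: (cvg_comp (fun d : R => d / 2)); last exact: cQ.
    by apply: cvgM; [exact: cvg_id|exact: cvg_cst].
  - exact: cvg_cst.
  - apply: (cvg_comp (fun d : R => - d / 2)); last exact: cQ.
    by apply: cvgM; [apply: (@cvgN _ R^o); exact: cvg_id|exact: cvg_cst].
have cN : threshold l (- 1) d @[d --> 0^'+] --> +oo.
  apply/cvgryPge => M; near=> d.
  have d0 : 0 < d by near: d; exact: nbhs_right_gt.
  have d1 : d < 1 by near: d; exact: nbhs_right_lt.
  have dl : d < l / (`|M| + 1).
    by near: d; apply: nbhs_right_lt; rewrite divr_gt0// ltr_wpDl.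
  have : `|M| + 1 < l / d.
    by rewrite ltr_pdivlMr// mulrC -ltr_pdivlMr// ltr_wpDl.
  by have := ler_norm M; rewrite /threshold; lra.
have cP : threshold l 1 d @[d --> 0^'+] --> +oo.
  apply: ger_cvgy cN; near=> d.
  have d0 : 0 < d by near: d; exact: nbhs_right_gt.
  by rewrite /threshold; lra.
rewrite /gap0 eqxx gt_eqF//= -[X in _ --> X](subr0 0).
apply: (@cvgB _ R^o).
  rewrite -[X in _ --> X](mulr0 (A * expR (l / 2))).
  apply: cvgM; first exact: cvg_cst.
  exact: (cvg_comp _ _ cP cvg_gaussQy).
rewrite -[X in _ --> X](mulr0 (B * expR (- (l / 2)))).
apply: cvgM; first exact: cvg_cst.
exact: (cvg_comp _ _ cN cvg_gaussQy).
Unshelve. all: by end_near. Qed.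

Lemma gap_decr l A B x y : 0 < x -> x < y ->
  (forall z, x < z -> z < y -> 2 * (l * (A - B)) < (A + B) * z ^+ 2) ->
  gap l A B y < gap l A B x.
Proof.
move=> x0 xy H.
have dgap z : x <= z -> is_derive z 1 (gap l A B)
    (gap_weight l z * (l * (A - B) / z ^+ 2 - (A + B) / 2)).
  by move=> xz; apply: is_derive_gap; rewrite gt_eqF// (lt_le_trans x0).
have cgap : {within `[x, y], continuous (gap l A B)}.
  apply: derivable_within_continuous => z; rewrite in_itv/= => /andP[xz _].
  by have [] := dgap _ xz.
have dgap' z : z \in `]x, y[ -> is_derive z 1 (gap l A B)
    (gap_weight l z * (l * (A - B) / z ^+ 2 - (A + B) / 2)).
  by rewrite in_itv/= => /andP[/ltW xz _]; exact: dgap.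
have [z] := MVT xy dgap' cgap.
rewrite in_itv/= => /andP[xz zy] e; rewrite -subr_lt0 e.
rewrite pmulr_llt0 ?subr_gt0// pmulr_rlt0 ?gap_weight_gt0//.
have z0 : 0 < z ^+ 2 by rewrite exprn_gt0// (lt_trans x0).
by rewrite subr_lt0 ltr_pdivrMr//; have := H _ xz zy; lra.
Qed.

(** Up to positive factors, the derivative of [gap] at [z] is
    [2 l (A - B) - (A + B) z^2]. *)
Lemma gap0_decr l A B x y : 0 <= l -> 0 <= x -> x < y ->
  (forall z, x < z -> z < y -> 2 * (l * (A - B)) < (A + B) * z ^+ 2) ->
  gap0 l A B y < gap0 l A B x.
Proof.
move=> l0 x0 xy H; have y0 : 0 < y by exact: le_lt_trans xy.
have -> : gap0 l A B y = gap l A B y by rewrite /gap0 gt_eqF.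
move: x0; rewrite le_eqVlt => /predU1P[x0|x0]; last first.
  have -> : gap0 l A B x = gap l A B x by rewrite /gap0 gt_eqF.
  exact: gap_decr.
(* Compare with the value at y / 2, which the limit at 0 bounds from above. *)
rewrite -x0 in xy H *; have y20 : 0 < y / 2 by rewrite divr_gt0.
have y2y : y / 2 < y by lra.
apply: (@lt_le_trans _ _ (gap l A B (y / 2))).
  by apply: gap_decr => // z z1; apply: H; exact: lt_trans z1.
apply: (cvgr_to_ge (cvg_gap_at0 (A := A) (B := B) l0)); near=> d.
have d0 : 0 < d by near: d; exact: nbhs_right_gt.
have dy : d < y / 2 by near: d; exact: nbhs_right_lt.
apply/ltW/gap_decr => // z z1 z2; apply: H; first exact: lt_trans z1.
exact: lt_trans y2y.
Unshelve. all: by end_near. Qed.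

Lemma gap0_incr l A B x y : 0 <= l -> 0 <= x -> x < y ->
  (forall z, x < z -> z < y -> (A + B) * z ^+ 2 < 2 * (l * (A - B))) ->
  gap0 l A B x < gap0 l A B y.
Proof.
move=> l0 x0 xy H; rewrite -ltrN2 -!gap0N; apply: gap0_decr => // z xz zy.
have -> : - A - - B = - (A - B) by ring.
by rewrite -opprD !mulrN mulNr ltrN2; exact: H.
Qed.

End Analysis.

(** * Minimizers of functions with a prescribed monotonicity *)

(** The points where [f] is minimal on the segment [[0, m]]. *)
Definition minimizers (R : realType) (m : R) (f : R -> R) : set R :=
  [set d | 0 <= d <= m /\ forall d', 0 <= d' <= m -> f d <= f d'].

(** The function [f] behaves as if its derivative at [z > 0] had the sign of
    [2 c - s z^2]. *)
Section Minimizers.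
Context {R : realType} (m c s : R) (f : R -> R).
Hypothesis m_gt0 : 0 < m.
Hypothesis f_decr : forall x y, 0 <= x -> x < y ->
  (forall z, x < z -> z < y -> 2 * c < s * z ^+ 2) -> f y < f x.
Hypothesis f_incr : forall x y, 0 <= x -> x < y ->
  (forall z, x < z -> z < y -> s * z ^+ 2 < 2 * c) -> f x < f y.

Lemma minimizers_unique p : 0 <= p <= m ->
  (forall d, 0 <= d <= m -> d != p -> f p < f d) -> minimizers m f = [set p].
Proof.
move=> pm H; apply/seteqP; split => [d [dm dmin]|_ ->].
  by apply/eqP/negP => /negP dp; have := dmin _ pm; rewrite leNgt H.
split=> // d dm; have [->//|dp] := eqVneq d p; exact/ltW/H.
Qed.

Lemma minimizers_interior : c < 0 -> s < 0 ->
  minimizers m f = [set Num.min m (Num.sqrt `|2 * c / s|)].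
Proof.
move=> c0 s0; set r := Num.sqrt _.
have cs : 0 < 2 * c / s by rewrite nmulr_rgt0 ?invr_lt0// pmulr_rlt0.
have r0 : 0 < r by rewrite sqrtr_gt0 normr_gt0 gt_eqF.
have rE : s * r ^+ 2 = 2 * c.
  by rewrite sqr_sqrtr// gtr0_norm// mulrC divfK// lt_eqF.
have below z : 0 <= z -> z < r -> 2 * c < s * z ^+ 2.
  by move=> z0 zr; rewrite -rE ltr_nM2l// ltr_pXn2r// nnegrE// ltW.
have above z : r < z -> s * z ^+ 2 < 2 * c.
  move=> zr; rewrite -rE ltr_nM2l// ltr_pXn2r// nnegrE ltW//.
  exact: lt_trans zr.
apply: minimizers_unique.
  by rewrite le_min ge_min lexx (ltW m_gt0) (ltW r0).
move=> d /andP[d0 dm] dp; have [rm|mr] := leP r m.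
  have /orP[dr|rd] : (d < r) || (r < d).
    by rewrite -neq_lt; move: dp; rewrite min_r.
  - by apply: f_decr => // z dz; apply: below; exact/ltW/(le_lt_trans d0).
  - by apply: f_incr => // [|z rz _]; [exact: ltW|exact: above].
have {dm dp} dm : d < m by rewrite lt_neqAle dm andbT; move: dp; rewrite min_l// ltW.
apply: f_decr => // z dz zm; apply: below; first exact/ltW/(le_lt_trans d0).
exact: lt_trans zm mr.
Qed.

Lemma minimizers_max : c < 0 -> 0 <= s -> minimizers m f = [set m].
Proof.
move=> c0 s0; apply: minimizers_unique; first by rewrite lexx ltW.
move=> d /andP[d0 dm] dnm; apply: f_decr => //; first by rewrite lt_neqAle dnm.
move=> z _ _; rewrite (@lt_le_trans _ _ 0)// ?pmulr_rlt0//.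
by rewrite mulr_ge0// sqr_ge0.
Qed.

Lemma minimizers_zero : 0 <= c -> s < 0 -> minimizers m f = [set 0].
Proof.
move=> c0 s0; apply: minimizers_unique; first by rewrite lexx ltW.
move=> d /andP[d0 dm] dn0.
have {}d0 : 0 < d by rewrite lt_neqAle eq_sym dn0.
apply: f_incr => // z z0 _; rewrite (@lt_le_trans _ _ 0)// ?mulr_ge0//.
by rewrite nmulr_rlt0// exprn_gt0.
Qed.

Lemma minimizers_zero_small : (s = 0 /\ 0 < c) \/ (0 < s /\ m ^+ 2 < 2 * c / s) ->
  minimizers m f = [set 0].
Proof.
move=> H; apply: minimizers_unique; first by rewrite lexx ltW.
move=> d /andP[d0 dm] dn0.
have {}d0 : 0 < d by rewrite lt_neqAle eq_sym dn0.
apply: f_incr => // z z0 zd; case: H => [[-> c0]|[s0]].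
  by rewrite mul0r mulr_gt0.
rewrite ltr_pdivlMr// mulrC; apply: lt_trans; rewrite ltr_pM2l//.
have zm : z < m by exact: lt_le_trans zd dm.
by rewrite ltr_pXn2r// nnegrE ltW.
Qed.

Lemma interior_not_minimal d : 0 < s -> 0 <= c -> 0 < d -> d < m ->
  f 0 < f d \/ f m < f d.
Proof.
move=> s0 c0 d0 dm; have [cd|dc] := leP (s * d ^+ 2) (2 * c).
  left; apply: f_incr => // z z0 zd; apply: lt_le_trans cd.
  by rewrite ltr_pM2l// ltr_pXn2r// nnegrE ltW.
right; apply: f_decr => // [|z dz _]; first exact: ltW.
apply: lt_trans dc _.
by rewrite ltr_pM2l// ltr_pXn2r// nnegrE ltW// (lt_trans d0).
Qed.

Lemma minimizers_endpoints : 0 < s -> 0 <= c ->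
  [/\ f m < f 0 -> minimizers m f = [set m],
      f 0 < f m -> minimizers m f = [set 0] &
      f 0 = f m -> minimizers m f = [set 0; m]].
Proof.
move=> s0 c0; have m0 := ltW m_gt0.
have H d : 0 <= d <= m -> d != 0 -> d != m -> f 0 < f d \/ f m < f d.
  move=> /andP[d0 dm] dn0 dnm; apply: interior_not_minimal => //.
    by rewrite lt_neqAle eq_sym dn0.
  by rewrite lt_neqAle dnm.
split.
- move=> fm; apply: minimizers_unique; first by rewrite lexx m0.
  move=> d dm dnm; have [->//|dn0] := eqVneq d 0.
  by case: (H _ dm dn0 dnm) => // f0; exact: lt_trans fm f0.
- move=> f0; apply: minimizers_unique; first by rewrite lexx m0.
  move=> d dm dn0; have [->//|dnm] := eqVneq d m.
  by case: (H _ dm dn0 dnm) => // fm; exact: lt_trans f0 fm.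
- move=> f0m.
  have f0 d : 0 <= d <= m -> f 0 <= f d.
    move=> dm; have [->//|dn0] := eqVneq d 0.
    have [->|dnm] := eqVneq d m; first by rewrite f0m.
    by case: (H _ dm dn0 dnm) => [|]; rewrite -?f0m => /ltW.
  apply/seteqP; split => [d [dm dmin]|d [->|->]].
  + have [->|dn0] := eqVneq d 0; first by left.
    have [->|dnm] := eqVneq d m; first by right.
    have f0d := dmin 0; have fmd := dmin m.
    case: (H _ dm dn0 dnm); rewrite ltNge.
      by rewrite f0d// lexx m0.
    by rewrite fmd// lexx m0.
  + by split; [rewrite lexx m0|exact: f0].
  + by split; [rewrite lexx m0|rewrite -f0m; exact: f0].
Qed.

End Minimizers.

(** * Best responses of the receiver *)

Section BestResponse.
Context {R : realType}.
Local Notation mu := (@lebesgue_measure R).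
Implicit Types (s : R) (S : @signals R) (delta : @decision_rule R) (p r : player R).

(** A measurable test, as a decision rule. *)
Definition rule_of (f : R -> bool)
    (mf : @measurable_fun _ _ (measurableTypeR R) bool setT f) : decision_rule :=
  @mfun_Sub _ _ (measurableTypeR R) bool f (mem_set mf).

Lemma measurable_rule delta (j : bool) :
  @measurable _ (measurableTypeR R) (delta @^-1` [set j]).
Proof.
rewrite -[X in measurable X]setTI.
exact: (@measurable_funPT _ _ _ _ delta).
Qed.

Lemma decision_probE s S delta (j i : bool) : 0 < s ->
  decision_prob s S delta j i = fine (normal_prob (S i) s (delta @^-1` [set j])).
Proof.
move=> s0; congr fine.
exact: (normal_prob_shift (S i) s0 (measurable_rule delta j)).
Qed.

Lemma decision_prob_false s S delta i : 0 < s ->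
  decision_prob s S delta false i = 1 - decision_prob s S delta true i.
Proof.
move=> s0; rewrite !decision_probE//.
have -> : delta @^-1` [set false] = ~` (delta @^-1` [set true]).
  by apply/seteqP; split => y /=; case: (delta y).
rewrite probability_setC; last exact: measurable_rule.
by rewrite fineB//; apply: fin_num_measure; exact: measurable_rule.
Qed.

Lemma bayes_riskE s p S delta : 0 < s ->
  bayes_risk s p S delta
  = prior p false * cost p false false + prior p true * cost p false true
    + tau_num p * decision_prob s S delta true false
    - tau_den p * decision_prob s S delta true true.
Proof.
move=> s0; rewrite /bayes_risk !decision_prob_false// /tau_num /tau_den.
by ring.
Qed.

Lemma decision_prob_const s S delta j i : 0 < s -> (forall y, delta y = j) ->
  decision_prob s S delta j i = 1.
Proof.
move=> s0 dj; rewrite decision_probE//.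
have -> : delta @^-1` [set j] = setT by apply/seteqP; split => y /= _ //; exact: dj.
by rewrite probability_setT.
Qed.

Lemma const_rule (j : bool) : exists delta : @decision_rule R, forall y, delta y = j.
Proof.
have mf : @measurable_fun _ _ (measurableTypeR R) bool setT (fun=> j) by exact: measurable_cst.
by exists (rule_of mf).
Qed.

Lemma const_rule_alarm s S delta j i : 0 < s -> (forall y, delta y = j) ->
  decision_prob s S delta true i = j%:R.
Proof.
move=> s0; case: j => dE; first exact: decision_prob_const.
by rewrite -[LHS](subKr 1) -decision_prob_false// decision_prob_const// subrr.
Qed.

Lemma alarm_region_itv delta (I : interval R) : (forall y, delta y = (y \in I)) ->
  delta @^-1` [set true] = [set` I].
Proof. by move=> E; apply/seteqP; split => y /=; rewrite E. Qed.

Lemma half_line_rule (x : R) :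
  exists delta : @decision_rule R, forall y, delta y = (x < y).
Proof.
have mf : @measurable_fun _ _ (measurableTypeR R) bool setT (fun y => x < y).
  exact: measurable_fun_ltr.
by exists (rule_of mf).
Qed.

Lemma half_line_neutral s S delta : 0 < s ->
  (forall y, delta y = (S false < y)) ->
  S false = S true ->
  decision_prob s S delta true false = decision_prob s S delta false true.
Proof.
move=> s0 dE Se; rewrite decision_prob_false// !decision_probE//.
rewrite (@alarm_region_itv _ `]S false, +oo[); last first.
  by move=> y; rewrite dE in_itv/= andbT.
by rewrite !normal_prob_open_ray// Se subrr mul0r gaussQ0/=; field.
Qed.

(** The density whose integral over the region where [H_1] is decided is the
    variable part of the risk. *)
Definition regret s p S (y : R) : R :=
  tau_num p * normal_pdf (S false) s y - tau_den p * normal_pdf (S true) s y.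

Lemma integrable_regret s p S (A : set R) : measurable A ->
  mu.-integrable A (EFin \o regret s p S).
Proof.
move=> mA; apply: (@integrableS _ _ _ _ setT) => //.
apply: (@eq_integrable _ _ _ mu _ measurableT
  ((fun y => (tau_num p)%:E * (normal_pdf (S false) s y)%:E)
   \- (fun y => (tau_den p)%:E * (normal_pdf (S true) s y)%:E))%E) => //.
by apply: integrableB => //; apply: integrableZl => //; exact: integrable_normal_pdf.
Qed.

Lemma Rintegral_regret s p S (A : set R) : measurable A ->
  \int[mu]_(y in A) regret s p S y
  = tau_num p * fine (normal_prob (S false) s A)
    - tau_den p * fine (normal_prob (S true) s A).
Proof.
move=> mA.
have I i : mu.-integrable A (EFin \o normal_pdf (S i) s).
  by apply: (@integrableS _ _ _ _ setT) => //; exact: integrable_normal_pdf.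
have Z i (k : R) : mu.-integrable A (EFin \o (fun y => k * normal_pdf (S i) s y)).
  apply: (@eq_integrable _ _ _ mu _ mA (fun y => k%:E * (normal_pdf (S i) s y)%:E)%E) => //.
  by apply: integrableZl => //; exact: I.
by rewrite RintegralB// !RintegralZl.
Qed.

(** A rule [delta] following the sign of the integrand, against an arbitrary
    rule [delta'].  The difference of their risks is the integral of [`|regret|]
    over the symmetric difference of the two regions. *)
Section Compare.
Variables (s : R) (p : player R) (S : @signals R) (delta delta' : @decision_rule R).
Hypothesis s_gt0 : 0 < s.
Hypothesis delta_neg : forall y, delta y -> regret s p S y <= 0.
Hypothesis delta_pos : forall y, ~~ delta y -> 0 <= regret s p S y.

Let G := delta @^-1` [set true].
Let A := delta' @^-1` [set true].
Let mG : measurable G. Proof. exact: measurable_rule. Qed.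
Let mA : measurable A. Proof. exact: measurable_rule. Qed.

Let setIDE (X Y : set R) : X = (X `&` Y) `|` (X `\` Y).
Proof. by rewrite setUIDK. Qed.

Let disjID (X Y : set R) : [disjoint X `&` Y & X `\` Y].
Proof.
by apply/disj_setPS => y [[_ Yy] [_ nYy]].
Qed.

Let risk_difference :
  bayes_risk s p S delta' - bayes_risk s p S delta
  = \int[mu]_(y in A `\` G) regret s p S y
    - \int[mu]_(y in G `\` A) regret s p S y.
Proof.
rewrite !bayes_riskE// !decision_probE//.
have split X Y : measurable X -> measurable Y ->
    \int[mu]_(y in X) regret s p S y = \int[mu]_(y in X `&` Y) regret s p S y
      + \int[mu]_(y in X `\` Y) regret s p S y.
  move=> mX mY; rewrite {1}(setIDE X Y) Rintegral_setU//.
  - exact: measurableI.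
  - exact: measurableD.
  - by rewrite -setIDE; exact: integrable_regret.
have := Rintegral_regret s p S mA; rewrite (split A G)//.
have := Rintegral_regret s p S mG; rewrite (split G A)// [G `&` A]setIC.
by rewrite /G /A; lra.
Qed.

Let in_ge0 : 0 <= \int[mu]_(y in A `\` G) regret s p S y.
Proof.
by apply: Rintegral_ge0 => y [_ /negP nG]; exact: delta_pos.
Qed.

Let out_le0 : \int[mu]_(y in G `\` A) regret s p S y <= 0.
Proof.
rewrite -oppr_ge0 -mulN1r -RintegralZl//; first last.
- exact/integrable_regret/measurableD.
- exact: measurableD.
by apply: Rintegral_ge0 => y [Gy _]; rewrite mulN1r oppr_ge0; exact: delta_neg.
Qed.

Lemma sign_rule_optimal : bayes_risk s p S delta <= bayes_risk s p S delta'.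
Proof. by rewrite -subr_ge0 risk_difference; move: in_ge0 out_le0; lra. Qed.

Let null_diff (D : set R) m : measurable D ->
  mu.-negligible [set y | regret s p S y = 0] ->
  \int[mu]_(y in D) `|regret s p S y| = 0 -> normal_prob m s D = 0%E.
Proof.
move=> mD neg iD0.
have iD : (\int[mu]_(y in D) `|(EFin \o regret s p S) y| = 0)%E.
  have fin : (\int[mu]_(y in D) `|(EFin \o regret s p S) y|)%E \is a fin_num.
    by apply: integrable_fin_num => //; apply: integrable_abse; exact: integrable_regret.
  by rewrite -(fineK fin); move: iD0; rewrite /Rintegral /= => ->.
have mr := measurable_int mu (integrable_regret s p S mD).
have [N [mN N0 sub]] := (ae_eq_integral_abs mu mD mr).1 iD.
have D0 : mu D = 0%E.
  apply: measure_negligible => //.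
  have neg' : mu.-negligible ([set y | regret s p S y = 0] `|` N).
    by apply: negligibleU => //; exists N; split.
  apply: negligibleS neg' => y Dy.
  have [r0|r0] := eqVneq (regret s p S y) 0; [by left|right].
  by apply: sub => /= /(_ Dy) [] /eqP; rewrite (negbTE r0).
have /null_content_dominatesP dom := @normal_prob_dominates R m s.
exact: dom.
Qed.

(** If [delta'] is as good as [delta] and [regret] vanishes only on a null set,
    then so is the symmetric difference of the two regions. *)
Lemma sign_rule_unique i :
  mu.-negligible [set y | regret s p S y = 0] ->
  bayes_risk s p S delta' <= bayes_risk s p S delta ->
  decision_prob s S delta' true i = decision_prob s S delta true i.
Proof.
move=> neg; rewrite -subr_le0 risk_difference => le0.
have in0 : \int[mu]_(y in A `\` G) regret s p S y = 0.
  by apply/eqP; rewrite eq_le in_ge0 andbT; move: out_le0 le0; lra.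
have out0 : \int[mu]_(y in G `\` A) regret s p S y = 0.
  by apply/eqP; rewrite eq_le out_le0/=; move: in_ge0 le0; lra.
have mAG : measurable (A `\` G) by exact: measurableD.
have mGA : measurable (G `\` A) by exact: measurableD.
have AG0 : normal_prob (S i) s (A `\` G) = 0%E.
  apply: null_diff => //; rewrite -[RHS]in0; apply: eq_Rintegral => y.
  by rewrite inE => -[_ /negP nG]; rewrite ger0_norm// delta_pos.
have GA0 : normal_prob (S i) s (G `\` A) = 0%E.
  apply: null_diff => //; rewrite -[RHS]oppr0 -[in RHS]out0 -mulN1r -RintegralZl//.
    apply: eq_Rintegral => y; rewrite inE => -[Gy _].
    by rewrite ler0_norm ?mulN1r// delta_neg.
  exact: integrable_regret.
rewrite !decision_probE//; congr fine; rewrite -/A -/G.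
have AE : normal_prob (S i) s A = normal_prob (S i) s (A `&` G).
  have -> := measureDI (normal_prob (S i) s) mA mG.
  by rewrite -[RHS]add0e; congr (_ + _)%E; exact: AG0.
have -> := measureDI (normal_prob (S i) s) mG mA.
by rewrite AE setIC -[LHS]add0e; congr (_ + _)%E; exact/esym/GA0.
Qed.

End Compare.
End BestResponse.

(** * The likelihood ratio test *)

Section LikelihoodRatio.
Context {R : realType}.
Local Notation mu := (@lebesgue_measure R).
Implicit Types (s L : R) (S : @signals R) (delta : @decision_rule R) (r : player R).

(** The logarithm of the likelihood ratio of the observation [y]. *)
Definition log_ratio s S (y : R) : R :=
  (S true - S false) * (y - (S false + S true) / 2) / s ^+ 2.

Lemma normal_pdf_ratio s S y : 0 < s ->
  normal_pdf (S true) s y = normal_pdf (S false) s y * expR (log_ratio s S y).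
Proof.
move=> s0; rewrite !normal_pdf_std// /std_density.
have -> : - (((y - S true) / s) ^+ 2 / 2)
    = - (((y - S false) / s) ^+ 2 / 2) + log_ratio s S y.
  by rewrite /log_ratio; field; rewrite gt_eqF.
by rewrite expRD; ring.
Qed.

(** The test of the log-likelihood ratio against [L]; the flag [b] exchanges the
    two decisions. *)
Definition lr_test_fun s S L (b : bool) (y : R) : bool :=
  if b then log_ratio s S y <= L else L < log_ratio s S y.

Lemma measurable_lr_test s S L b :
  @measurable_fun _ _ (measurableTypeR R) bool setT (lr_test_fun s S L b).
Proof.
have mlr : @measurable_fun _ _ (measurableTypeR R) R setT (log_ratio s S).
  apply: measurable_funM => //; apply: measurable_funM => //.
  exact: measurable_funB.
rewrite /lr_test_fun; case: b.
  exact: measurable_fun_ler.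
exact: measurable_fun_ltr.
Qed.

Definition lr_test s S L b : @decision_rule R := rule_of (measurable_lr_test s S L b).

Lemma lr_testE s S L b y :
  lr_test s S L b y = if b then log_ratio s S y <= L else L < log_ratio s S y.
Proof. by []. Qed.

Lemma dist_eq0 s S : 0 < s -> dist s S = 0 <-> S false = S true.
Proof.
move=> s0; rewrite /dist; split => [/eqP|->]; last by rewrite subrr normr0 mul0r.
rewrite mulf_eq0 invr_eq0 (gt_eqF s0) orbF normr_eq0 subr_eq0 eq_sym.
by move=> /eqP.
Qed.

Lemma dist_gt0_neq s S : 0 < s -> 0 < dist s S -> S false != S true.
Proof.
by move=> s0 dS; apply/eqP => /(dist_eq0 S s0) dS0; rewrite dS0 ltxx in dS.
Qed.

Lemma log_ratio_eq s S y : S false = S true -> log_ratio s S y = 0.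
Proof. by move=> e; rewrite /log_ratio e subrr !mul0r. Qed.

(** The observation at which the log-likelihood ratio equals [L]. *)
Definition lr_point s S L : R :=
  (S false + S true) / 2 + s ^+ 2 * L / (S true - S false).

Lemma lr_pointE s S L y : 0 < s -> S false != S true ->
  log_ratio s S y - L = (S true - S false) / s ^+ 2 * (y - lr_point s S L).
Proof.
move=> s0 Sne; rewrite /log_ratio /lr_point; field.
by rewrite (gt_eqF s0) subr_eq0 eq_sym Sne.
Qed.

Lemma lr_test_alarm_false s S L (i : bool) : 0 < s -> S false != S true ->
  decision_prob s S (lr_test s S L false) true i
  = gaussQ (threshold L ((- 1) ^+ i) (dist s S)).
Proof.
move=> s0 Sne; rewrite decision_probE//.
have /orP[S01|S10] : (S false < S true) || (S true < S false) by rewrite -neq_lt.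
- have -> : lr_test s S L false @^-1` [set true] = `]lr_point s S L, +oo[%classic.
    apply: alarm_region_itv => y; rewrite lr_testE in_itv/= andbT -subr_gt0 lr_pointE//.
    by rewrite pmulr_rgt0 ?subr_gt0// divr_gt0 ?subr_gt0 ?exprn_gt0.
  rewrite normal_prob_open_ray//=; congr gaussQ.
  rewrite /threshold /lr_point /dist gtr0_norm ?subr_gt0//.
  by case: i; rewrite ?expr1 ?expr0; field; rewrite (gt_eqF s0) subr_eq0 (gt_eqF S01).
- have -> : lr_test s S L false @^-1` [set true] = `]-oo, lr_point s S L[%classic.
    apply: alarm_region_itv => y; rewrite lr_testE in_itv/= -subr_gt0 lr_pointE//.
    by rewrite nmulr_rgt0 ?subr_lt0// pmulr_llt0 ?subr_lt0// invr_gt0 exprn_gt0.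
  rewrite normal_prob_left_ray//= -gaussQN; congr gaussQ.
  rewrite /threshold /lr_point /dist ltr0_norm ?subr_lt0//.
  case: i; rewrite ?expr1 ?expr0; field;
    by rewrite (gt_eqF s0) ?opprB !subr_eq0 ?(gt_eqF S10) (lt_eqF S10).
Qed.

Lemma lr_test_flip s S L i : 0 < s ->
  decision_prob s S (lr_test s S L true) true i
  = 1 - decision_prob s S (lr_test s S L false) true i.
Proof.
move=> s0; have H y : lr_test s S L true y = ~~ lr_test s S L false y.
  by rewrite !lr_testE leNgt.
rewrite -decision_prob_false//; congr (fine (normal_prob _ _ _)).
move: (lr_test s S L true) (lr_test s S L false) H => d1 d2 H.
by apply/seteqP; split => n /=; rewrite H; case: (d2 _).
Qed.

Lemma lr_test_alarm s S L b i : 0 < s -> S false != S true ->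
  decision_prob s S (lr_test s S L b) true i
  = let q := gaussQ (threshold L ((- 1) ^+ i) (dist s S)) in if b then 1 - q else q.
Proof.
by move=> s0 Sne; case: b; rewrite ?lr_test_flip// lr_test_alarm_false.
Qed.

Lemma lr_test_alarm_eq s S L b i : 0 < s -> S false = S true ->
  decision_prob s S (lr_test s S L b) true i
  = (if b then 0 <= L else L < 0)%:R.
Proof.
move=> s0 Se; have E y : lr_test s S L b y = if b then 0 <= L else L < 0.
  by rewrite lr_testE log_ratio_eq.
move: E; case: (if b then _ else _) => E; first exact: decision_prob_const.
rewrite -[LHS](subKr 1) -decision_prob_false// decision_prob_const//.
by rewrite subrr.
Qed.

(** The receiver's best responses when the threshold is [tau = e^L]. *)
Section Receiver.
Variables (s L : R) (r : player R).
Hypothesis s_gt0 : 0 < s.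
Hypothesis den_neq0 : tau_den r != 0.
Hypothesis num_den : tau_num r = expR L * tau_den r.
Local Notation b := (tau_den r < 0).

Lemma regret_lr S y : regret s r S y
  = tau_den r * (normal_pdf (S false) s y * (expR L - expR (log_ratio s S y))).
Proof. by rewrite /regret normal_pdf_ratio// num_den; ring. Qed.

Lemma lr_test_regret_neg S y : lr_test s S L b y -> regret s r S y <= 0.
Proof.
rewrite regret_lr lr_testE; case: ifPn => [den0 le|].
  rewrite nmulr_rle0// pmulr_rge0 ?normal_pdf_gt0//.
  by rewrite subr_ge0 ler_expR.
rewrite -leNgt => den0 lt.
have {}den0 : 0 < tau_den r by rewrite lt_neqAle eq_sym den_neq0.
rewrite pmulr_rle0// pmulr_rle0 ?normal_pdf_gt0//.
by rewrite subr_le0 ler_expR ltW.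
Qed.

Lemma lr_test_regret_pos S y : ~~ lr_test s S L b y -> 0 <= regret s r S y.
Proof.
rewrite regret_lr lr_testE; case: ifPn => [den0|].
  rewrite -ltNge => lt; rewrite nmulr_rge0// pmulr_rle0 ?normal_pdf_gt0//.
  by rewrite subr_le0 ler_expR ltW.
rewrite -leNgt => den0; rewrite -leNgt => le.
have {}den0 : 0 < tau_den r by rewrite lt_neqAle eq_sym den_neq0.
rewrite pmulr_rge0// pmulr_rge0 ?normal_pdf_gt0//.
by rewrite subr_ge0 ler_expR.
Qed.

Lemma lr_test_best_response S : best_response s r S (lr_test s S L b).
Proof.
move=> delta; apply: sign_rule_optimal => // y.
  exact: lr_test_regret_neg.
exact: lr_test_regret_pos.
Qed.

Lemma best_response_alarm S delta i : S false != S true \/ L != 0 ->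
  best_response s r S delta ->
  decision_prob s S delta true i = decision_prob s S (lr_test s S L b) true i.
Proof.
move=> ne br; apply: sign_rule_unique => //.
- exact: lr_test_regret_neg.
- exact: lr_test_regret_pos.
have zero y : regret s r S y = 0 -> log_ratio s S y = L.
  move=> /eqP; rewrite regret_lr mulf_eq0 (negbTE den_neq0)/=.
  rewrite mulf_eq0 gt_eqF ?normal_pdf_gt0//= subr_eq0 => /eqP e.
  exact/esym/expR_inj.
exists [set lr_point s S L]; split => //; first exact: lebesgue_measure_set1.
move=> y /= /zero yL; have [Se|Sne] := eqVneq (S false) (S true).
  by case: ne; rewrite ?Se ?eqxx// -yL log_ratio_eq// eqxx.
have := lr_pointE L y s_gt0 Sne; rewrite yL subrr => /esym/eqP.
rewrite !mulf_eq0 invr_eq0 expf_eq0/= (gt_eqF s_gt0) !subr_eq0.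
by rewrite [S true == _]eq_sym (negbTE Sne)/= => /eqP.
Qed.

End Receiver.
End LikelihoodRatio.

(** * Equilibrium distances for a finite positive threshold *)

Section Signals.
Context {R : realType} (s : R) (P : bool -> R).
Hypothesis s_gt0 : 0 < s.
Hypothesis P_gt0 : forall i, 0 < P i.

Lemma dist_max_gt0 : 0 < dist_max s P.
Proof. by rewrite divr_gt0// addr_gt0// sqrtr_gt0. Qed.

Lemma dist_range S : feasible P S -> 0 <= dist s S <= dist_max s P.
Proof.
move=> feas; have le i : `|S i| <= Num.sqrt (P i).
  by rewrite -(ger0_norm (normr_ge0 (S i))) -sqrtr_sqr ler_wsqrtr.
rewrite divr_ge0 ?(ltW s_gt0)//= ler_pM2r ?invr_gt0//.
by rewrite (le_trans (ler_normB _ _))// addrC lerD.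
Qed.

(** Every distance in the range is reached by scaling the extreme signals
    [-sqrt(P_0)] and [sqrt(P_1)]. *)
Lemma dist_surj d : 0 <= d <= dist_max s P ->
  exists2 S, feasible P S & dist s S = d.
Proof.
move=> /andP[d0 dm]; pose c := d / dist_max s P.
have c0 : 0 <= c by rewrite divr_ge0// ltW// dist_max_gt0.
have c1 : c <= 1 by rewrite ler_pdivrMr ?dist_max_gt0// mul1r.
have m0 := dist_max_gt0.
exists (fun i => (if i then 1 else -1) * Num.sqrt (P i) * c).
  move=> i; rewrite real_normK ?num_real// !exprMn sqr_sqrtr ?(ltW (P_gt0 i))//.
  have -> : (if i then 1 else -1 : R) ^+ 2 = 1 by case: i; rewrite ?sqrrN expr1n.
  by rewrite mul1r; apply: ler_piMr; [exact/ltW|rewrite -exprMn exprn_ile1].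
rewrite /dist mul1r mulN1r mulNr opprK -mulrDl ger0_norm; last first.
  by rewrite mulr_ge0// addr_ge0.
by rewrite mulrAC addrC mulrC /c divfK// gt_eqF.
Qed.

(** The leader's problem, over the follower's strategies in a class [C] that
    make the leader's risk a function of the distance. *)
Lemma stackelberg_dists t r (C : (signals -> decision_rule) -> Prop) (K : R) (f : R -> R) :
  (forall delta, C delta ->
     (forall S, feasible P S -> best_response s r S (delta S)) ->
     forall S, feasible P S -> bayes_risk s t S (delta S) = K + f (dist s S)) ->
  (exists2 delta, C delta & forall S, feasible P S -> best_response s r S (delta S)) ->
  [set d | exists S delta, [/\ stackelberg s P t r S delta, C delta & d = dist s S]]
  = minimizers (dist_max s P) f.
Proof.
move=> value [delta0 C0 br0]; apply/seteqP; split => [_ [S [delta [[fS br opt] Cd ->]]]|].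
  split=> [|d /dist_surj [S' fS' <-]]; first exact: dist_range.
  by have := opt _ fS'; rewrite !(value delta)// lerD2l.
move=> d [/dist_surj [S fS <-] dmin]; exists S, delta0; split => //; split => // S' fS'.
by rewrite !(value delta0)// lerD2l dmin// dist_range.
Qed.

End Signals.

(** The game when the receiver's threshold is [tau = e^L]. *)
Section Transmitter.
Context {R : realType} (s L : R) (P : bool -> R) (t r : player R).
Hypothesis s_gt0 : 0 < s.
Hypothesis P_gt0 : forall i, 0 < P i.
Hypothesis den_neq0 : tau_den r != 0.
Hypothesis num_den : tau_num r = expR L * tau_den r.
Local Notation b := (tau_den r < 0).

(** The sign of the denominator of [tau], that is, of the receiver's cost
    difference under [H_1]. *)
Definition orientation : R := if b then -1 else 1.
(** The constants [k0] and [k1] of the characterization. *)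
Definition weight0 : R := orientation * tau_num t * expR (- (L / 2)).
Definition weight1 : R := orientation * tau_den t * expR (L / 2).
(** The part of the risk that does not depend on the signals; when [tau_den r < 0]
    the two decisions are exchanged, which adds the second term. *)
Definition base_risk : R :=
  prior t false * cost t false false + prior t true * cost t false true
  + (if b then tau_num t - tau_den t else 0).

Lemma transmitter_risk S delta (x : bool -> R) :
  (forall i, decision_prob s S delta true i = if b then 1 - x i else x i) ->
  bayes_risk s t S delta = base_risk + (weight0 * expR (L / 2) * x false
    - weight1 * expR (- (L / 2)) * x true).
Proof.
move=> xE; rewrite bayes_riskE// !xE /base_risk /weight0 /weight1 /orientation.
have : expR (L / 2) * expR (- (L / 2)) = 1 by rewrite -expRD subrr expR0.
move: (expR _) (expR _) => p q; set u := tau_num t; set v := tau_den t => pq.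
have -> (w : R) : w * u * p * q = w * u by rewrite -mulrA [p * q]mulrC pq mulr1.
have -> (w : R) : w * v * q * p = w * v by rewrite -mulrA pq mulr1.
by case: ifP => _; ring.
Qed.

(** For [L < 0], the identity [Q(-x) = 1 - Q(x)] turns the risk into a constant,
    [offset], plus the same expression with [-L] instead of [L] and the two
    weights exchanged; hence the use of [`|L|] and of the weights ordered by
    [lead] and [trail]. *)
Definition offset : R :=
  if L < 0 then weight0 * expR (L / 2) - weight1 * expR (- (L / 2)) else 0.
Definition lead : R := if L < 0 then weight1 else weight0.
Definition trail : R := if L < 0 then weight0 else weight1.
(** The transmitter's risk as a function of the distance, up to a constant. *)
Definition profile : R -> R := gap0 `|L| lead trail.

Lemma signed_gapE d :
  weight0 * expR (L / 2) * gaussQ (threshold L 1 d)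
  - weight1 * expR (- (L / 2)) * gaussQ (threshold L (- 1) d)
  = offset + gap `|L| lead trail d.
Proof.
rewrite /offset /lead /trail /gap; case: (ltrP L 0) => [L0|L0]; last first.
  by rewrite ger0_norm// add0r.
rewrite ltr0_norm//.
have -> : threshold (- L) 1 d = - threshold L (- 1) d by rewrite /threshold; ring.
have -> : threshold (- L) (- 1) d = - threshold L 1 d by rewrite /threshold; ring.
by rewrite !gaussQN mulNr opprK; ring.
Qed.

Lemma transmitter_risk_distinct S delta : S false != S true ->
  best_response s r S delta ->
  bayes_risk s t S delta = base_risk + offset + profile (dist s S).
Proof.
move=> Sne br.
rewrite (@transmitter_risk _ _ (fun i => gaussQ (threshold L ((- 1) ^+ i) (dist s S)))).
  rewrite expr0 expr1 signed_gapE addrA /profile /gap0.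
  case: eqP => //= d0; have := (dist_eq0 S s_gt0).1 d0.
  by move=> /eqP; rewrite (negbTE Sne).
move=> i; rewrite (best_response_alarm s_gt0 den_neq0 num_den i _ br); last by left.
exact: lr_test_alarm.
Qed.

Lemma transmitter_risk_equal S delta : L != 0 -> S false = S true ->
  best_response s r S delta ->
  bayes_risk s t S delta = base_risk + offset + profile (dist s S).
Proof.
move=> L0 Se br; rewrite (@transmitter_risk _ _ (fun _ => (L < 0)%R%:R)).
  have -> : dist s S = 0 by apply/dist_eq0.
  rewrite /profile /gap0 eqxx normr_eq0 L0/= addr0; congr (_ + _).
  by rewrite /offset; case: ifP => _; rewrite ?mulr1// !mulr0 subr0.
move=> i; rewrite (best_response_alarm s_gt0 den_neq0 num_den i _ br); last by right.
rewrite lr_test_alarm_eq// leNgt.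
by case: ifP => _; case: (L < 0); rewrite ?subrr ?subr0.
Qed.

Lemma transmitter_risk_best_response S delta : L != 0 ->
  best_response s r S delta ->
  bayes_risk s t S delta = base_risk + offset + profile (dist s S).
Proof.
move=> L0 br; have [Se|Sne] := eqVneq (S false) (S true).
  exact: transmitter_risk_equal.
exact: transmitter_risk_distinct.
Qed.

Lemma tie_best_response S delta : L = 0 -> S false = S true ->
  best_response s r S delta.
Proof.
move=> L0 Se delta'; have h y : regret s r S y = 0.
  by rewrite /regret num_den L0 expR0 mul1r Se subrr.
by apply: sign_rule_optimal => // y _; rewrite h.
Qed.

Lemma profile_tie : L = 0 -> profile 0 = (weight0 - weight1) / 2.
Proof.
move=> L0; rewrite /profile /lead /trail /gap0 L0 ltxx normr0 eqxx andbF /gap /threshold.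
by rewrite /= !mulr0 !mul0r add0r oppr0 expR0 gaussQ0; field.
Qed.

Lemma offset_tie : L = 0 -> offset = 0.
Proof. by move=> L0; rewrite /offset L0 ltxx. Qed.

Lemma transmitter_risk_tie S delta x : L = 0 ->
  (forall i, decision_prob s S delta true i = if b then 1 - x else x) ->
  bayes_risk s t S delta = base_risk + (weight0 - weight1) * x.
Proof.
move=> L0 /(@transmitter_risk S delta (fun=> x)) ->.
by rewrite L0 mul0r oppr0 expR0 !mulr1 mulrBl.
Qed.

(** Neutral ties make both error probabilities [1/2], and the risk is then the
    limit of the risk for distinct signals. *)
Lemma transmitter_risk_neutral S delta : L = 0 -> best_response s r S delta ->
  (S false = S true ->
    decision_prob s S delta true false = decision_prob s S delta false true) ->
  bayes_risk s t S delta = base_risk + offset + profile (dist s S).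
Proof.
move=> L0 br neutral; have [Se|Sne] := eqVneq (S false) (S true); last first.
  exact: transmitter_risk_distinct.
have -> : dist s S = 0 by apply/dist_eq0.
rewrite offset_tie// addr0 profile_tie//; apply: transmitter_risk_tie => // i.
have half : decision_prob s S delta true true = 2^-1.
  have := neutral Se; rewrite decision_prob_false//.
  have -> : decision_prob s S delta true false = decision_prob s S delta true true.
    by rewrite /decision_prob Se.
  by lra.
have -> : decision_prob s S delta true i = 2^-1.
  by rewrite -half; case: i => //; rewrite /decision_prob Se.
by case: ifP => _ //; field.
Qed.

Lemma profile_decr x y : 0 <= x -> x < y ->
  (forall z, x < z -> z < y ->
     2 * (L * (weight0 - weight1)) < (weight0 + weight1) * z ^+ 2) ->
  profile y < profile x.
Proof.
move=> x0 xy H; apply: gap0_decr => // z xz zy.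
have := H z xz zy; rewrite /lead /trail; case: (ltrP L 0) => L0.
  rewrite ltr0_norm// mulNr -mulrN opprB.
  by rewrite [weight1 + _]addrC.
by rewrite ger0_norm.
Qed.

Lemma profile_incr x y : 0 <= x -> x < y ->
  (forall z, x < z -> z < y ->
     (weight0 + weight1) * z ^+ 2 < 2 * (L * (weight0 - weight1))) ->
  profile x < profile y.
Proof.
move=> x0 xy H; apply: gap0_incr => // z xz zy.
have := H z xz zy; rewrite /lead /trail; case: (ltrP L 0) => L0.
  rewrite ltr0_norm// mulNr -mulrN opprB.
  by rewrite [weight1 + _]addrC.
by rewrite ger0_norm.
Qed.

(** The value at [m] has the sign opposite to that of the criterion comparing the
    two endpoints, since the value at [0] is [0]. *)
Lemma profile_criterion m : L != 0 -> 0 < m -> 0 < lead ->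
  profile m = - (lead * expR (`|L| / 2)) *
    ((weight1 / (weight0 * expR L)) ^ (sgz L) * gaussQ (`|L| / m - m / 2)
     - gaussQ (`|L| / m + m / 2)).
Proof.
move=> L0 m0 lead0; rewrite /profile /gap0 gt_eqF//= /gap.
have -> : threshold `|L| 1 m = `|L| / m + m / 2 by rewrite /threshold mul1r.
have -> : threshold `|L| (- 1) m = `|L| / m - m / 2 by rewrite /threshold mulN1r mulNr.
move: (gaussQ _) (gaussQ _) => x y.
suff e : trail * expR (- (`|L| / 2))
    = lead * expR (`|L| / 2) * (weight1 / (weight0 * expR L)) ^ sgz L.
  by rewrite e; ring.
move: lead0; rewrite /lead /trail; case: (ltrP L 0) => [Ln w|Lp w].
  rewrite ltr0_norm// ltr0_sgz// exprN1 invf_div.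
  have -> : expR L = expR (- (- L / 2)) * expR (- (- L / 2)).
    by rewrite -expRD; congr expR; field.
  have : expR (- L / 2) * expR (- (- L / 2)) = 1 by rewrite -expRD subrr expR0.
  move: (expR _) (expR _) => p q pq.
  transitivity ((q * p) * (weight0 * p)); first by rewrite pq mul1r.
  by field; rewrite gt_eqF.
have {}Lp : 0 < L by rewrite lt_neqAle eq_sym L0.
rewrite gtr0_norm// gtr0_sgz// expr1z.
have -> : expR L = expR (L / 2) * expR (L / 2).
  by rewrite -expRD; congr expR; field.
rewrite expRN; have := expR_gt0 (L / 2); move: (expR _) => p p0.
by field; rewrite !gt_eqF.
Qed.

Lemma dists_minimizers : L != 0 ->
  equilibrium_dists s P t r = minimizers (dist_max s P) profile.
Proof.
move=> L0; rewrite -(stackelberg_dists (t := t) (r := r) (C := fun=> True) s_gt0 P_gt0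
  (K := base_risk + offset)).
- apply/seteqP; split => d [S [delta]]; first by move=> [? ?]; exists S, delta.
  by move=> [? _ ?]; exists S, delta.
- by move=> delta _ br S fS; apply: transmitter_risk_best_response => //; exact: br.
- by exists (fun S => lr_test s S L b) => // S _; exact: lr_test_best_response.
Qed.

Lemma neutral_dists_minimizers : L = 0 ->
  neutral_equilibrium_dists s P t r = minimizers (dist_max s P) profile.
Proof.
move=> L0; rewrite -(stackelberg_dists (t := t) (r := r) (C := neutral_ties s P)
  s_gt0 P_gt0 (K := base_risk + offset)) //.
- move=> delta nt br S fS; apply: transmitter_risk_neutral => // [|Se].
    exact: br.
  exact: nt.
- have /choice [half halfE] x : exists delta : @decision_rule R, forall y, delta y = (x < y).
    exact: half_line_rule.
  exists (fun S => if S false == S true then half (S false) else lr_test s S L b).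
    move=> S fS Se; rewrite Se eqxx -{1 2}Se.
    by apply: half_line_neutral.
  move=> S _; case: eqP => Se; first exact: tie_best_response.
  exact: lr_test_best_response.
Qed.

(** For [tau = 1] and equal signals the receiver may take, for all of them, the
    constant decision preferred by the transmitter. *)
Lemma dists_tie_zero : L = 0 -> weight0 + weight1 < 0 ->
  equilibrium_dists s P t r = [set 0].
Proof.
move=> L0 w0; have m0 := dist_max_gt0 s_gt0 P_gt0.
have incr x y : 0 <= x -> x < y -> profile x < profile y.
  move=> x0 xy; apply: profile_incr => // z xz _.
  by rewrite L0 mul0r mulr0 nmulr_rlt0// exprn_gt0// (le_lt_trans x0).
apply/seteqP; split => [_ [S [delta [[fS br opt] ->]]]|_ ->].
  have /andP[d0 dm] := dist_range s_gt0 fS.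
  apply/eqP/negP => /negP dn0.
  have {}d0 : 0 < dist s S by rewrite lt_neqAle eq_sym dn0.
  have d2 : 0 < dist s S / 2 by rewrite divr_gt0.
  (* Halving a positive distance improves the transmitter's risk. *)
  have [|S' fS' d'] := @dist_surj _ s P s_gt0 P_gt0 (dist s S / 2).
    by apply/andP; split; lra.
  have := opt _ fS'; rewrite !transmitter_risk_distinct//; last 4 first.
  - by apply: (dist_gt0_neq s_gt0); rewrite d'.
  - exact: br.
  - exact: dist_gt0_neq d0.
  - exact: br.
  by rewrite lerD2l leNgt d' incr//; lra.
pose j := (weight0 < weight1) (+) b.
have [cst cstE] := @const_rule R j.
pose x : R := (weight0 < weight1)%R%:R.
have xE S i : decision_prob s S cst true i = if b then 1 - x else x.
  rewrite (const_rule_alarm _ _ s_gt0 cstE) /j /x.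
  by case: b; case: (_ < _); rewrite /= ?subrr ?subr0.
exists (fun=> 0), (fun S => if S false == S true then cst else lr_test s S L b).
split; last by rewrite /dist subrr normr0 mul0r.
have br S : best_response s r S (if S false == S true then cst else lr_test s S L b).
  case: eqP => Se; first exact: tie_best_response.
  exact: lr_test_best_response.
split => [i|S _|S fS]; [by rewrite normr0 expr0n/= ltW|exact: br|].
rewrite eqxx (transmitter_risk_tie L0 (xE _)).
case: (eqVneq (S false) (S true)) => [Se|Sne].
  by rewrite (transmitter_risk_tie L0 (xE _)).
rewrite transmitter_risk_distinct//; last exact: lr_test_best_response.
rewrite offset_tie// addr0 lerD2l.
apply: (@le_trans _ _ (profile 0)).
  rewrite profile_tie// /x; case: ltP => ww; rewrite /= ?mulr1 ?mulr0; lra.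
have /andP[d0 _] := dist_range s_gt0 fS.
move: d0; rewrite le_eqVlt => /predU1P[<-//|d0]; exact/ltW/incr.
Qed.

(** Whatever the receiver does at equal signals, an interior distance is worse
    than the largest one. *)
Lemma dists_tie_sub : L = 0 -> 0 < weight0 + weight1 ->
  equilibrium_dists s P t r `<=` [set 0; dist_max s P].
Proof.
move=> L0 w0 _ [S [delta [[fS br opt] ->]]]; have m0 := dist_max_gt0 s_gt0 P_gt0.
have /andP[d0 dm] := dist_range s_gt0 fS.
have [->|dn0] := eqVneq (dist s S) 0; first by left.
have [->|dnm] := eqVneq (dist s S) (dist_max s P); first by right.
have {}d0 : 0 < dist s S by rewrite lt_neqAle eq_sym dn0.
have {}dm : dist s S < dist_max s P by rewrite lt_neqAle dnm.
have [|S' fS' d'] := @dist_surj _ s P s_gt0 P_gt0 (dist_max s P).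
  by rewrite lexx ltW.
have := opt _ fS'; rewrite !transmitter_risk_distinct//; last 4 first.
- by apply: (dist_gt0_neq s_gt0); rewrite d'.
- exact: br.
- exact: dist_gt0_neq d0.
- exact: br.
rewrite lerD2l leNgt d' profile_decr// 1?ltW// => z dz _.
by rewrite L0 mul0r mulr0 mulr_gt0// exprn_gt0// (lt_trans d0).
Qed.

(** For distinct signals, the probability of either decision lies strictly
    between [0] and [1]; for equal signals, the decision is constant if
    [tau <> 1], and both decisions are optimal for the priors if [tau = 1]. *)
Lemma informative_dist S delta : best_response s r S delta ->
  (dist s S = 0 <-> non_informative s r S delta).
Proof.
move=> br; split.
  move/(dist_eq0 S s_gt0) => Se; have [L0|L0] := eqVneq L 0.
    left; split => //; apply: aeW => y k.
    have : prior_cost r true = prior_cost r false.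
      apply/eqP; rewrite -subr_eq0; apply/eqP.
      transitivity (tau_num r - tau_den r).
        by rewrite /prior_cost /tau_num /tau_den; ring.
      by rewrite num_den L0 expR0 mul1r subrr.
    by move=> e; case: (delta y); case: k; rewrite ?e.
  right; exists ((L < 0) (+) b) => i.
  have alarm : decision_prob s S delta true i = ((L < 0) (+) b)%:R.
    rewrite (best_response_alarm s_gt0 den_neq0 num_den i _ br); last by right.
    by rewrite lr_test_alarm_eq// leNgt; case: b; case: (L < 0).
  by move: alarm; case: (_ (+) _) => alarm //; rewrite decision_prob_false// alarm subr0.
move=> [[Se _]|[j same]]; first exact/dist_eq0.
apply/(dist_eq0 S s_gt0)/eqP/negP => /negP Sne.
have := same true; set q := gaussQ (threshold L ((- 1) ^+ true) (dist s S)).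
have q0 : 0 < q by exact: gaussQ_gt0.
have q1 : q < 1 by exact: gaussQ_lt1.
have alarm : decision_prob s S delta true true = if b then 1 - q else q.
  rewrite (best_response_alarm s_gt0 den_neq0 num_den true _ br); last by left.
  exact: lr_test_alarm.
case: j {same} => [|]; rewrite ?decision_prob_false// alarm; case: ifP => _; lra.
Qed.

End Transmitter.

(** * Degenerate thresholds and the characterization *)

(** The case where the decision [j] is strictly better than the other one for
    every observation. *)
Section Degenerate.
Context {R : realType} (s : R) (P : bool -> R) (t r : player R).
Hypothesis s_gt0 : 0 < s.
Hypothesis P_gt0 : forall i, 0 < P i.
Variable j : bool.
Hypothesis regret_sign : forall S y,
  if j then regret s r S y < 0 else 0 < regret s r S y.

Lemma const_best_response S (delta : @decision_rule R) : (forall y, delta y = j) ->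
  best_response s r S delta.
Proof.
move=> dE delta'; apply: sign_rule_optimal => // y; rewrite dE;
  by have := regret_sign S y; case: j => // /ltW.
Qed.

Lemma best_response_const S (delta : @decision_rule R) i : best_response s r S delta ->
  decision_prob s S delta j i = 1.
Proof.
move=> br; have [cst cstE] := @const_rule R j.
have e : decision_prob s S delta true i = decision_prob s S cst true i.
  apply: (@sign_rule_unique _ s r) => //.
  - by move=> y; rewrite cstE; have := regret_sign S y; case: j => // /ltW.
  - by move=> y; rewrite cstE; have := regret_sign S y; case: j => // /ltW.
  - rewrite [X in negligible _ X](_ : _ = set0); first exact: negligible_set0.
    apply/seteqP; split => y //= ry; have := regret_sign S y.
    by rewrite ry; case: ifP; rewrite ltxx.
move: e (decision_prob_const S i s_gt0 cstE).
by case: j => [-> //|]; rewrite !decision_prob_false// => ->.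
Qed.

Lemma degenerate_equilibria :
  (exists S delta, stackelberg s P t r S delta) /\
  (forall S delta, stackelberg s P t r S delta -> non_informative s r S (delta S)).
Proof.
have [cst cstE] := @const_rule R j.
split=> [|S delta [fS br _]]; last first.
  by right; exists j => i; exact/best_response_const/br.
exists (fun=> 0), (fun=> cst); split.
- by move=> i; rewrite normr0 expr0n/= ltW.
- by move=> S _; exact: const_best_response.
- by move=> S _; rewrite !bayes_riskE// !(const_rule_alarm _ _ s_gt0 cstE).
Qed.

End Degenerate.

(** Here [tau_num] and [- tau_den] have the same weak sign and are not both [0],
    and [H_1] is the better decision where the integrand is negative. *)
Lemma tau_ext_degenerate (R : realType) (s : R) (r : player R) : 0 < s ->
  ~ (tau_num r = 0 /\ tau_den r = 0) ->
  (tau_ext r <= 0)%E \/ tau_ext r = +oo%E ->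
  exists j : bool, forall S y,
    if j then regret s r S y < 0 else 0 < regret s r S y.
Proof.
move=> s0 nz H.
have pos a c S y : 0 <= a -> 0 <= c -> ~ (a = 0 /\ c = 0) ->
    0 < a * normal_pdf (S false : R) s y + c * normal_pdf (S true : R) s y.
  move=> a0 c0 ac; have f0 := normal_pdf_gt0 (S false) y s0.
  have f1 := normal_pdf_gt0 (S true) y s0.
  move: a0; rewrite le_eqVlt => /predU1P[a0|a0].
    rewrite -a0 mul0r add0r mulr_gt0// lt_neqAle c0 andbT; apply/eqP => c00.
    by apply: ac; split.
  by rewrite ltr_wpDr ?mulr_gt0// mulr_ge0// ltW.
have : (tau_num r <= 0 /\ 0 <= tau_den r) \/ (0 <= tau_num r /\ tau_den r <= 0).
  move: H; rewrite /tau_ext; case: ifPn => [den0|/negPn/eqP ->]; last first.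
    by case: ltP => n0 _; [right; rewrite ltW|left].
  rewrite lee_fin => -[|//]; move: den0; rewrite neq_lt => /orP[d0|d0].
    by rewrite ler_ndivrMr// mul0r => ->; right; rewrite ltW.
  by rewrite ler_pdivrMr// mul0r => ->; left; rewrite ltW.
move=> [[n0 d0]|[n0 d0]].
  exists true => S y; rewrite -oppr_gt0 /regret opprB addrC -mulNr; apply: pos => //.
    by rewrite oppr_ge0.
  by move=> [/eqP]; rewrite oppr_eq0 => /eqP n00 d00; apply: nz.
exists false => S y; rewrite /regret -mulNr; apply: pos => //.
  by rewrite oppr_ge0.
by move=> [n00 /eqP]; rewrite oppr_eq0 => /eqP d00; apply: nz.
Qed.

Theorem theorem3p1 (R : realType) (sigma : R) (P : bool -> R)
    (t r : player R)
    (sigma_gt0 : 0 < sigma) (P_gt0 : forall i, 0 < P i)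
    (t_wf : player_wf t) (r_wf : player_wf r)
    (priors_ac : forall i, prior t i = 0 <-> prior r i = 0)
    (tau_welldef : ~ (tau_num r = 0 /\ tau_den r = 0)) :
  (((tau_ext r <= 0)%E \/ tau_ext r = +oo%E) ->
    (exists S delta, stackelberg sigma P t r S delta) /\
    (forall S delta, stackelberg sigma P t r S delta ->
       non_informative sigma r S (delta S)))
  /\
  ((0 < tau_ext r)%E -> (tau_ext r < +oo)%E ->
    let tau := fine (tau_ext r) in
    let dmax := dist_max sigma P in
    let zeta := Num.sg (cost r false true - cost r true true) in
    let k0 := prior t false * zeta * (cost t true false - cost t false false)
              * tau `^ (- 2^-1) in
    let k1 := prior t true * zeta * (cost t false true - cost t true true)
              * tau `^ (2^-1) in
    let D := equilibrium_dists sigma P t r in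
    let ratio := critical_ratio tau k0 k1 in
    let q := (k1 / (k0 * tau)) ^ (sgz (ln tau))
               * gaussQ (`|ln tau| / dmax - dmax / 2)
             - gaussQ (`|ln tau| / dmax + dmax / 2) in
    (forall S delta, stackelberg sigma P t r S delta ->
       (dist sigma S = 0 <-> non_informative sigma r S (delta S)))
    /\ (ln tau * (k0 - k1) < 0 -> k0 + k1 < 0 ->
          D = [set Num.min dmax
                 (Num.sqrt `|2 * ln tau * (k0 - k1) / (k0 + k1)|)])
    /\ (ln tau * (k0 - k1) < 0 -> 0 <= k0 + k1 -> D = [set dmax])
    /\ (0 <= ln tau * (k0 - k1) -> k0 + k1 < 0 -> D = [set 0])
    /\ (0 <= ln tau * (k0 - k1) -> 0 <= k0 + k1 ->
          ~ (k0 + k1 = 0 /\ ln tau * (k0 - k1) = 0) ->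
          (((dmax ^+ 2)%:E < ratio)%E -> D = [set 0])
          /\ ((ratio <= (dmax ^+ 2)%:E)%E ->
                (0 < q ->
                   (tau <> 1 -> D = [set dmax])
                   /\ (tau = 1 -> D `<=` [set 0; dmax]
                         /\ neutral_equilibrium_dists sigma P t r = [set dmax]))
                /\ (q < 0 -> D = [set 0])
                /\ (q = 0 -> D = [set 0; dmax])))).
Proof.
split=> [degenerate|tau_gt0 tau_lty].
  have [j regret_sign] := tau_ext_degenerate sigma_gt0 tau_welldef degenerate.
  exact: degenerate_equilibria regret_sign.
have [den_neq0 tauE] : tau_den r != 0 /\ tau_ext r = (tau_num r / tau_den r)%:E.
  move: tau_gt0 tau_lty; rewrite /tau_ext; case: ifP => //.
  by case: ifP.
rewrite tauE /= => {tau_lty}; move: tau_gt0; rewrite tauE lte_fin => {tauE}.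
set tau := tau_num r / tau_den r => tau_gt0.
set dmax := dist_max sigma P; set L := ln tau.
have tau_expR : tau = expR L by rewrite lnK.
have num_den : tau_num r = expR L * tau_den r by rewrite -tau_expR divfK.
have zetaE : Num.sg (cost r false true - cost r true true) = orientation r.
  have [prior_ge0 _ _] := r_wf; rewrite /orientation.
  have prior_gt0 : 0 < prior r true.
    rewrite lt_neqAle prior_ge0 andbT eq_sym; apply: contraNneq den_neq0.
    by rewrite /tau_den => ->; rewrite mul0r.
  move: den_neq0; rewrite /tau_den mulf_eq0 gt_eqF//= => c0.
  by rewrite pmulr_rlt0// /Num.sg (negbTE c0).
rewrite zetaE.
have powE (x : R) : tau `^ x = expR (x * L) by rewrite /powR gt_eqF.
have -> : prior t false * orientation r * (cost t true false - cost t false false)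
    * tau `^ (- 2^-1) = weight0 L t r.
  by rewrite powE /weight0 /tau_num mulNr [2^-1 * L]mulrC; ring.
have -> : prior t true * orientation r * (cost t false true - cost t true true)
    * tau `^ (2^-1) = weight1 L t r.
  by rewrite powE /weight1 /tau_den [2^-1 * L]mulrC; ring.
set k0 := weight0 L t r; set k1 := weight1 L t r.
have dmax_gt0 : 0 < dmax by exact: dist_max_gt0.
have decr := @profile_decr _ L t r; have incr := @profile_incr _ L t r.
have dists : L != 0 ->
    equilibrium_dists sigma P t r = minimizers dmax (profile L t r).
  exact: dists_minimizers.
rewrite -/k0 -/k1 in decr incr.
split=> [S delta [fS br _]|].
  exact: (informative_dist sigma_gt0 den_neq0 num_den (br S fS)).
have nontie : L * (k0 - k1) != 0 -> L != 0.
  by apply: contraNneq => ->; rewrite mul0r.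
split.
  move=> c0 s0; rewrite dists ?nontie ?lt_eqF//.
  by rewrite -(mulrA 2 L); exact: (minimizers_interior dmax_gt0 decr incr).
split=> [c0 s0|].
  by rewrite dists ?nontie ?lt_eqF//; exact: (minimizers_max dmax_gt0 decr c0).
split=> [c0 s0|c0 s0 cs].
  have [L0|L0] := eqVneq L 0.
    exact: (dists_tie_zero sigma_gt0 P_gt0 den_neq0 num_den L0).
  by rewrite dists//; exact: (minimizers_zero dmax_gt0 incr c0).
rewrite /critical_ratio -/L; split.
  move=> small; have L0 : L != 0.
    apply: contra_notN cs => /eqP L0; split; last by rewrite L0 mul0r.
    (* For L = 0 the critical ratio is 0 and cannot exceed dmax ^ 2. *)
    move: small; rewrite L0 mulr0 !mul0r normr0; case: eqP => // _.
    by rewrite lte_fin ltNge sqr_ge0.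
  rewrite dists//; apply: (minimizers_zero_small dmax_gt0 incr).
  move: small; case: eqP => [s00 _|/eqP sn0].
    left; split=> //; rewrite lt_neqAle c0 andbT eq_sym.
    by apply/eqP => c00; apply: cs.
  have {}s0 : 0 < k0 + k1 by rewrite lt_neqAle eq_sym sn0.
  rewrite lte_fin -(mulrA 2 L) ger0_norm => [small|]; first by right.
  by apply: divr_ge0; [apply: mulr_ge0|exact: ltW].
case: eqP => // /eqP sn0 _.
have {}s0 : 0 < k0 + k1 by rewrite lt_neqAle eq_sym sn0.
have [to_max to_zero both] := minimizers_endpoints dmax_gt0 decr incr s0 c0.
have [L0|L0] := eqVneq L 0.
  (* The criterion reduces to Q(- dmax / 2) - Q(dmax / 2), which is positive. *)
  have tau1 : tau = 1 by rewrite tau_expR L0 expR0.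
  rewrite L0 sgz0 expr0z mul1r normr0 mul0r sub0r add0r.
  have q0 : 0 < gaussQ (- (dmax / 2)) - gaussQ (dmax / 2).
    by rewrite subr_gt0 gaussQ_decr//; lra.
  split=> [_|]; last by split=> q1; move: q0; rewrite ?q1 ?ltxx// ltNge ltW.
  split=> // _; split; first exact: (dists_tie_sub sigma_gt0 P_gt0 den_neq0 num_den L0).
  have -> : neutral_equilibrium_dists sigma P t r = minimizers dmax (profile L t r).
    exact: neutral_dists_minimizers.
  apply: to_max; apply: decr => // z z0 _.
  by rewrite L0 mul0r mulr0 mulr_gt0// exprn_gt0.
have tau_neq1 : tau <> 1.
  by move=> tau1; move: L0; rewrite /L tau1 ln1 eqxx.
have lead_gt0 : 0 < lead L t r.
  rewrite /lead -/k0 -/k1; case: (ltP L 0) => Ls.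
    by move: c0; rewrite nmulr_rge0//; lra.
  by move: c0; rewrite pmulr_rge0 ?lt_neqAle 1?eq_sym ?L0//; lra.
have profile0 : profile L t r 0 = 0 by rewrite /profile /gap0 eqxx normr_eq0 L0.
have := profile_criterion L0 dmax_gt0 lead_gt0; rewrite -/k0 -/k1 -tau_expR.
set q := (_ - _) => crit.
have crit_gt0 : 0 < lead L t r * expR (`|L| / 2) by rewrite mulr_gt0 ?expR_gt0.
rewrite dists//; split=> [q0|]; [split=> // _|split=> q0].
- by apply: to_max; rewrite profile0 crit mulNr oppr_lt0 mulr_gt0.
- by apply: to_zero; rewrite profile0 crit mulNr oppr_gt0 pmulr_rlt0.
- by apply: both; rewrite profile0 crit q0 mulr0.
Qed.
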